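(* Let $N$ be a positive integer. Suppose that for every $\epsilon>0$ there exists a constant $C_\epsilon$ such that $f(\mathbf{a},\epsilon)<C_\epsilon$ for every ABC-solution $\mathbf{a}=(a,b,c)$ with $N\mid abc$. Then for every $\epsilon>0$ there exists a constant $C'_\epsilon$ such that $f(\mathbf{a},\epsilon)<C'_\epsilon$ for every ABC-solution $\mathbf{a}$ (i.e. the full ABC conjecture holds).
   Context: An ABC-solution is a triple $\mathbf{a}=(a,b,c)$ of distinct integers with $\gcd(a,b,c)=1$, $a+b+c=0$, and $a<0$, $b<0$ (so $c>0$). For a positive integer $n$, $\mathrm{rad}(n)$ denotes the product of the distinct primes dividing $n$, and $\mathrm{rad}(abc)$ means $\mathrm{rad}(|abc|)$. For $\epsilon>0$ and an ABC-solution $\mathbf{a}=(a,b,c)$, set $f(\mathbf{a},\epsilon)=\log c-(1+\epsilon)\log\mathrm{rad}(abc)$. *)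

(* Defs.v *)
From HB Require Import structures.
From mathcomp Require Import all_boot all_order all_algebra.
From mathcomp Require Import reals exp.

Set Implicit Arguments.
Unset Strict Implicit.
Unset Printing Implicit Defensive.

Import Order.TTheory GRing.Theory Num.Theory.
Local Open Scope ring_scope.

Definition ABC_solution (a b c : int) : Prop :=
  [/\ [/\ a <> b, b <> c & a <> c],
      gcdz (gcdz a b) c = 1,
      a + b + c = 0 &
      a < 0 /\ b < 0].

Definition radn (n : nat) : nat := (\prod_(p <- primes n) p)%N.

Definition ABC_f (R : realType) (a b c : int) (eps : R) : R :=
  ln (c%:~R) - (1 + eps) * ln ((radn `|(a * b * c)%R|%N)%:R).

(* Main.v *)
(** Let [c = x + y] and [d = x - y] for coprime [x > y > 0], and let [C], [D] be
    [c], [d] divided by their gcd, which is 1 or 2.  For a suitable even [n]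
    depending only on [N], Euler's theorem gives [N | D^n (C^n - D^n) C^n], so
    the hypothesis applies to the triple [(- D^n, - (C^n - D^n), C^n)].  As
    [c^2 - d^2 = 4 x y] divides [c^n - d^n], the radical of this triple is at
    most [rad (x y c) * n * c^(n - 1)].  The hypothesis at [delta] thus bounds
    [(1 - (n - 1) delta) ln c - (1 + delta) ln rad (x y c)] from above, and
    [delta] is chosen so that the ratio of the two coefficients is [1 + eps]. *)

Require Import Defs.
From HB Require Import structures.
From mathcomp Require Import all_boot all_order all_algebra.
From mathcomp Require Import reals exp.
From mathcomp Require Import cyclic zify ring lra.

Set Implicit Arguments.
Unset Strict Implicit.
Unset Printing Implicit Defensive.

Import Order.TTheory GRing.Theory Num.Theory.

Section Radical.
Local Open Scope nat_scope.
Implicit Types k m n : nat.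

Lemma radn_gt0 n : 0 < radn n.
Proof.
rewrite /radn big_seq; apply: prodn_cond_gt0 => p.
by rewrite mem_primes => /and3P[/prime_gt0].
Qed.

Lemma leq_radn n : 0 < n -> radn n <= n.
Proof.
move=> n_gt0; rewrite [leqRHS]prod_prime_decomp // /radn /primes big_map.
rewrite !big_seq leq_prod // => -[p e] /mem_prime_decomp[p_prime e_gt0 _] /=.
by rewrite -{1}(expn1 p) leq_exp2l ?prime_gt1.
Qed.

Lemma leq_radn_primes m n : {subset primes m <= primes n} -> radn m <= radn n.
Proof.
move=> sub_mn; apply: dvdn_leq (radn_gt0 n) _.
by apply: uniq_sub_le_big; rewrite ?primes_uniq // => a b; exact: dvdn_mulr.
Qed.

Lemma leq_radn_dvdX m n k : 0 < n -> m %| n ^ k -> radn m <= radn n.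
Proof.
move=> n_gt0 m_dvd; apply: leq_radn_primes => p.
rewrite !mem_primes n_gt0 => /and3P[p_prime _ p_dvd].
by have := dvdn_trans p_dvd m_dvd; rewrite Euclid_dvdX // p_prime => /andP[].
Qed.

Lemma leq_radnM m n : 0 < m -> 0 < n -> radn (m * n) <= radn m * radn n.
Proof.
move=> m_gt0 n_gt0; apply: dvdn_leq; first by rewrite muln_gt0 !radn_gt0.
rewrite -big_cat; apply: sub_le_big_seq => // [? ?|p]; first exact: dvdn_mulr.
rewrite count_uniq_mem ?primes_uniq // primesM // -mem_cat.
by case: (boolP (p \in _)); rewrite -?has_pred1 ?has_count.
Qed.

End Radical.

Section PowerCongruences.
Local Open Scope nat_scope.
Implicit Types m n x y : nat.

Lemma totient_partn_dvd pi n : 0 < n -> totient n`_pi %| totient n.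
Proof.
move=> n_gt0; rewrite -{2}(partnC pi n_gt0) totient_coprime ?coprime_partC //.
exact: dvdn_mulr.
Qed.

Lemma Euler_exp_totient_dvd x m n :
  coprime x m -> totient m %| n -> x ^ n = 1 %[mod m].
Proof.
move=> co_xm /dvdnP[k ->]; rewrite mulnC expnM -modnXm Euler_exp_totient //.
by rewrite modnXm exp1n.
Qed.

Lemma eqmod_dvdn_sub m x y : x = y %[mod m] -> m %| x - y.
Proof.
have [y_le_x /eqP|/ltnW] := leqP y x; first by rewrite eqn_mod_dvd.
by rewrite -subn_eq0 => /eqP ->.
Qed.

Lemma dvdn_expn_sub_expn N n x y :
  0 < N -> N <= n -> totient N %| n -> N %| y ^ n * (x ^ n - y ^ n) * x ^ n.
Proof.
move=> N_gt0 N_le_n totN_dvd; apply/(dvdn_partP _ N_gt0) => p.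
rewrite mem_primes => /and3P[p_prime _ _].
have part_dvd z : p %| z -> N`_p %| z ^ n.
  move=> p_dvd_z; rewrite p_part (dvdn_trans _ (dvdn_exp2r n p_dvd_z)) //.
  exact/dvdn_exp2l/(leq_trans _ N_le_n)/ltnW/ltn_logl.
have [/part_dvd x_dvd|p_ndvd_x] := boolP (p %| x); first exact: dvdn_mull.
have [/part_dvd y_dvd|p_ndvd_y] := boolP (p %| y).
  by rewrite -mulnA dvdn_mulr.
have expn_eq1 z : ~~ (p %| z) -> z ^ n = 1 %[mod N`_p].
  move=> p_ndvd_z; apply: Euler_exp_totient_dvd; last first.
    exact: dvdn_trans (totient_partn_dvd p N_gt0) totN_dvd.
  by rewrite p_part coprimeXr // coprime_sym prime_coprime.
by apply/dvdn_mulr/dvdn_mull/eqmod_dvdn_sub; rewrite !expn_eq1.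
Qed.

End PowerCongruences.

Section PowersAndGcd.
Local Open Scope nat_scope.
Implicit Types k m n x y : nat.

Lemma expn_neq_primeM p n x y :
  prime p -> 1 < n -> 0 < y -> x ^ n != p * y ^ n.
Proof.
move=> p_prime n_gt1 y_gt0; apply/eqP => /(congr1 (logn p)).
rewrite lognM ?expn_gt0 ?(prime_gt0 p_prime) ?y_gt0 //.
rewrite !lognX (logn_prime _ p_prime) eqxx => logn_eq.
have n_dvd_logn q z : n %| n * logn q z by apply: dvdn_mulr.
have : n %| 1 by rewrite -(dvdn_addl 1 (n_dvd_logn p y)) -logn_eq.
by rewrite dvdn1 => /eqP n_eq1; rewrite n_eq1 in n_gt1.
Qed.

Lemma subn_exp_factor k m n : 0 < k -> n < m ->
  exists2 s, m ^ k - n ^ k = (m - n) * s & 0 < s <= k * m ^ k.-1.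
Proof.
move=> k_gt0 lt_nm; exists (\sum_(i < k) m ^ (k.-1 - i) * n ^ i).
  exact: subn_exp.
apply/andP; split.
  have : 0 < m ^ k - n ^ k by rewrite subn_gt0 ltn_exp2r.
  by rewrite subn_exp muln_gt0 => /andP[].
rewrite -[X in X * _]card_ord -sum_nat_const leq_sum // => i _.
have i_le : i <= k.-1 by rewrite -ltnS prednK.
rewrite -[X in _ <= _ ^ X](subnK i_le) expnD leq_mul2l; apply/orP; right.
by case: (posnP i) => [->|i_gt0] //; rewrite leq_exp2r // ltnW.
Qed.

Lemma subn_sqrD_sqrB x y : y <= x -> (x + y) ^ 2 - (x - y) ^ 2 = 4 * (x * y).
Proof.
move=> y_le_x; have -> : 4 * (x * y) = (2 * y) * (2 * x) by ring.
by rewrite subn_sqr; congr (_ * _); lia.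
Qed.

Lemma gcdn_addn_subn_dvd x y : y <= x -> gcdn (x + y) (x - y) %| 2 * gcdn x y.
Proof.
move=> y_le_x; set g := gcdn _ _.
have [dvd_add dvd_sub] : g %| x + y /\ g %| x - y.
  by rewrite dvdn_gcdl dvdn_gcdr.
rewrite muln_gcdr dvdn_gcd; apply/andP; split.
  by have -> : 2 * x = (x + y) + (x - y); [lia | exact: dvdn_add].
by have -> : 2 * y = (x + y) - (x - y); [lia | exact: dvdn_sub].
Qed.

Lemma coprime_divn_gcdn m n :
  0 < gcdn m n -> coprime (m %/ gcdn m n) (n %/ gcdn m n).
Proof.
move=> g_gt0; rewrite /coprime -(eqn_pmul2r g_gt0) mul1n muln_gcdl.
by rewrite !divnK ?dvdn_gcdl ?dvdn_gcdr.
Qed.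

End PowersAndGcd.

Section PowerTriple.
Local Open Scope nat_scope.
Implicit Types h n x y : nat.

Lemma leq_radn_power_triple h x y (n := h.*2) (c := x + y) (d := x - y) :
  0 < h -> 0 < y < x ->
  radn (d ^ n * (c ^ n - d ^ n) * c ^ n)
    <= radn (x * y * c) * (n * c ^ n.-1).
Proof.
move=> h_gt0 /andP[y_gt0 lt_yx].
have d_gt0 : 0 < d by rewrite subn_gt0.
have c_gt0 : 0 < c by rewrite addn_gt0 y_gt0 orbT.
have xyc_gt0 : 0 < x * y * c.
  by rewrite !muln_gt0 y_gt0 c_gt0 (leq_trans _ lt_yx).
have lt_dc2 : d ^ 2 < c ^ 2 by rewrite ltn_exp2r // /d /c; lia.
have [s] := subn_exp_factor h_gt0 lt_dc2.
rewrite -!expnM mul2n (subn_sqrD_sqrB (ltnW lt_yx)) => sub_eq /andP[s_gt0 s_le].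
have n_ge2 : 2 <= n by rewrite /n; lia.
have ds_gt0 : 0 < 2 * d * s by rewrite !muln_gt0 d_gt0.
rewrite sub_eq; apply: (@leq_trans (radn (x * y * c * (2 * d * s)))).
  apply: (@leq_radn_dvdX _ _ n); first by rewrite muln_gt0 xyc_gt0.
  have -> : (x * y * c * (2 * d * s)) ^ n
      = d ^ n * (2 ^ n * (x * y) ^ n * s ^ n) * c ^ n by rewrite !expnMn; ring.
  have self_dvd z : z %| z ^ n by rewrite dvdn_exp // ltnW.
  apply/dvdn_mul/dvdnn/dvdn_mul => //.
  by rewrite !dvdn_mul ?self_dvd ?(@dvdn_exp2l 2 2).
apply: leq_trans (leq_radnM xyc_gt0 ds_gt0) _.
rewrite leq_mul2l; apply/orP; right; apply: leq_trans (leq_radn ds_gt0) _.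
have -> : n * c ^ n.-1 = 2 * c * (h * c ^ (2 * h.-1)).
  have -> : n.-1 = (2 * h.-1).+1 by rewrite /n; lia.
  by rewrite /n expnS; lia.
by rewrite leq_mul // leq_mul2l /d /c; lia.
Qed.

(* Encodes the solution [(- x, - y, x + y)]. *)
Definition ABC_pair x y := [&& 0 < x, 0 < y, x != y & coprime x y].

Lemma ABC_pairC x y : ABC_pair x y = ABC_pair y x.
Proof. by rewrite /ABC_pair andbCA eq_sym coprime_sym. Qed.

Lemma ABC_pair_addn_gt0 x y : ABC_pair x y -> 0 < x + y.
Proof. by case/and4P=> x_gt0 _ _ _; rewrite addn_gt0 x_gt0. Qed.

Lemma ABC_pair_power_triple n x y :
  1 < n -> 0 < y < x -> coprime x y -> ABC_pair (y ^ n) (x ^ n - y ^ n).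
Proof.
move=> n_gt1 /andP[y_gt0 lt_yx] co_xy; have n_gt0 := ltnW n_gt1.
have lt_pow : y ^ n < x ^ n by rewrite ltn_exp2r.
rewrite /ABC_pair expn_gt0 y_gt0 subn_gt0 lt_pow /=; apply/andP; split.
  have := @expn_neq_primeM 2 n x y isT n_gt1 y_gt0; lia.
rewrite /coprime -gcdnDl subnKC ?(ltnW lt_pow) //.
by rewrite -/(coprime _ _) coprimeXl // coprimeXr // coprime_sym.
Qed.

Lemma reduced_addn_subn x y : 0 < y < x -> coprime x y ->
  exists C D g, [/\ x + y = C * g, x - y = D * g, 0 < g <= 2, 0 < D < C
    & coprime C D].
Proof.
move=> /andP[y_gt0 lt_yx] co_xy; pose g := gcdn (x + y) (x - y).
have g_dvd2 : g %| 2.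
  by have := gcdn_addn_subn_dvd (ltnW lt_yx); rewrite (eqP co_xy) muln1.
have g_gt0 : 0 < g by apply: dvdn_gt0 g_dvd2.
have addE : x + y = (x + y) %/ g * g by rewrite divnK ?dvdn_gcdl.
have subE : x - y = (x - y) %/ g * g by rewrite divnK ?dvdn_gcdr.
exists ((x + y) %/ g), ((x - y) %/ g), g; split=> //.
- by rewrite g_gt0 dvdn_leq.
- apply/andP; split; rewrite -(ltn_pmul2r g_gt0) -subE -?addE; lia.
- exact: coprime_divn_gcdn.
Qed.

Lemma congruent_ABC_pair N h x y (n := h.*2) :
  0 < N -> N <= n -> totient N %| n -> ABC_pair x y ->
  exists u v, [/\ ABC_pair u v, N %| u * v * (u + v),
    (x + y) ^ n <= 2 ^ n * (u + v) &
    radn (u * v * (u + v)) <= radn (x * y * (x + y)) * (n * (x + y) ^ n.-1)].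
Proof.
move=> N_gt0 N_le_n totN_dvd.
wlog lt_yx : x y / y < x.
  move=> wlog_yx xy_pair; have /and4P[_ _ neq_xy _] := xy_pair.
  have [lt_xy|lt_yx|eq_xy] := ltngtP x y; last by rewrite eq_xy eqxx in neq_xy.
    by rewrite addnC (mulnC x); apply: wlog_yx; rewrite // ABC_pairC.
  exact: wlog_yx.
case/and4P=> _ y_gt0 _ co_xy; have yx_pos : 0 < y < x by rewrite y_gt0.
have n_gt0 : 0 < n by apply: leq_trans N_le_n.
have h_gt0 : 0 < h by rewrite -double_gt0.
have [C [D [g [addE subE /andP[g_gt0 g_le2] DC_pos co_CD]]]] :=
  reduced_addn_subn yx_pos co_xy.
have le_pow : D ^ n <= C ^ n by rewrite leq_exp2r // ltnW //; case/andP: DC_pos.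
exists (D ^ n), (C ^ n - D ^ n); rewrite subnKC //; split.
- by apply: ABC_pair_power_triple; rewrite // /n; lia.
- exact: dvdn_expn_sub_expn.
- by rewrite addE mulnC -expnMn leq_exp2r // leq_mul2r g_le2 orbT.
- apply: leq_trans (leq_radn_power_triple h_gt0 yx_pos).
  rewrite -/n; apply: (@leq_radn_dvdX _ _ 1).
    by rewrite !muln_gt0 !expn_gt0 !subn_gt0 ltn_exp2r //; lia.
  by rewrite expn1 addE subE !expnMn -mulnBl !dvdn_mul ?dvdn_mulr.
Qed.

End PowerTriple.

Local Open Scope ring_scope.

Section IntegerTriples.
Implicit Types (a b c : int) (x y : nat).

Lemma ABC_solution_pair x y :
  ABC_pair x y -> ABC_solution (- x%:Z) (- y%:Z) (x + y)%:Z.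
Proof.
case/and4P=> x_gt0 y_gt0 /eqP neq_xy /eqP co_xy.
split; [by split; lia| |lia|by split; lia].
by rewrite /gcdz !abszN !absz_nat co_xy gcd1n.
Qed.

Lemma ABC_solution_exists_pair a b c : ABC_solution a b c ->
  exists x y, [/\ ABC_pair x y, a = - x%:Z, b = - y%:Z & c = (x + y)%:Z].
Proof.
case=> -[neq_ab _ _] gcd_abc sum0 [a_lt0 b_lt0]; exists `|a|%N, `|b|%N.
split; try lia; apply/and4P; split; try lia.
move: gcd_abc; have -> : c = - (a + b) by lia.
rewrite /gcdz abszN !absz_nat => -[gcd_eq1]; rewrite /coprime -dvdn1 -gcd_eq1.
rewrite dvdn_gcd dvdnn /=; have -> : `|(a + b)%R|%N = (`|a| + `|b|)%N by lia.
by rewrite dvdn_add ?dvdn_gcdl ?dvdn_gcdr.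
Qed.

Lemma absz_ABC_product x y :
  `|(- x%:Z * - y%:Z * (x + y)%:Z)%R|%N = (x * y * (x + y))%N.
Proof. by rewrite mulrNN -!PoszM absz_nat. Qed.

End IntegerTriples.

Section Estimates.
Variable R : realType.
Implicit Types (eps K : R) (m n x y u v : nat).

Lemma ler_ln_nat m n : (0 < m)%N -> (m <= n)%N -> ln m%:R <= ln n%:R :> R.
Proof.
move=> m_gt0 le_mn; have n_gt0 := leq_trans m_gt0 le_mn.
by rewrite ler_ln ?posrE ?ltr0n ?ler_nat.
Qed.

Lemma ln_natM m n : (0 < m)%N -> (0 < n)%N ->
  ln (m * n)%:R = ln m%:R + ln n%:R :> R.
Proof. by move=> m_gt0 n_gt0; rewrite natrM lnM ?posrE ?ltr0n. Qed.

Lemma ln_natX m n : (0 < m)%N -> ln (m ^ n)%:R = n%:R * ln m%:R :> R.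
Proof. by move=> m_gt0; rewrite natrX lnXn ?ltr0n // mulr_natl. Qed.

Definition ABC_pair_f eps x y : R :=
  ln (x + y)%:R - (1 + eps) * ln (radn (x * y * (x + y)))%:R.

Lemma ABC_f_pairE eps x y :
  ABC_f (- x%:Z) (- y%:Z) (x + y)%:Z eps = ABC_pair_f eps x y.
Proof. by rewrite /ABC_f absz_ABC_product -pmulrn. Qed.

Definition contracted_eps n eps := eps / (1 + (1 + eps) * n.-1%:R).

Lemma contracted_eps_den_gt0 n eps : 0 < eps -> 0 < 1 + (1 + eps) * n.-1%:R.
Proof.
by move=> eps_gt0; rewrite ltr_pwDl // mulr_ge0 ?ler0n // addr_ge0 // ltW.
Qed.

Lemma contracted_eps_gt0 n eps : 0 < eps -> 0 < contracted_eps n eps.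
Proof. by move=> eps_gt0; rewrite divr_gt0 ?contracted_eps_den_gt0. Qed.

Lemma contracted_epsE n eps (delta := contracted_eps n eps) : 0 < eps ->
  1 + delta = (1 - n.-1%:R * delta) * (1 + eps).
Proof.
move=> eps_gt0; rewrite /delta /contracted_eps; field.
by rewrite gt_eqF ?contracted_eps_den_gt0.
Qed.

Lemma ABC_pair_f_descent n eps K x y u v (delta := contracted_eps n eps) :
    (0 < n)%N -> 0 < eps -> ABC_pair x y -> ABC_pair u v ->
    ((x + y) ^ n <= 2 ^ n * (u + v))%N ->
    (radn (u * v * (u + v))
      <= radn (x * y * (x + y)) * (n * (x + y) ^ n.-1))%N ->
    ABC_pair_f delta u v < K ->
  ABC_pair_f eps x y
    < (K + n%:R * ln 2 + (1 + delta) * ln n%:R) / (1 - n.-1%:R * delta).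
Proof.
move=> n_gt0 eps_gt0 /ABC_pair_addn_gt0 xy_gt0 /ABC_pair_addn_gt0 uv_gt0.
move=> /(ler_ln_nat _) le_pow le_rad lt_K.
have one_plus_delta_gt0 : 0 < 1 + delta by rewrite addr_gt0 ?contracted_eps_gt0.
have deltaE : 1 + delta = (1 - n.-1%:R * delta) * (1 + eps).
  exact: contracted_epsE.
have slope_gt0 : 0 < 1 - n.-1%:R * delta.
  by rewrite -(@pmulr_lgt0 _ (1 + eps)) -?deltaE // addr_gt0.
have ln_pow : n%:R * ln (x + y)%:R <= n%:R * ln 2 + ln (u + v)%:R :> R.
  by rewrite -!ln_natX // -ln_natM ?expn_gt0 // le_pow // expn_gt0 xy_gt0.
have := ler_ln_nat (radn_gt0 _) le_rad.
rewrite !ln_natM ?muln_gt0 ?radn_gt0 ?n_gt0 ?expn_gt0 ?xy_gt0 // ln_natX //.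
move=> /(ler_wpM2l (ltW one_plus_delta_gt0)) ln_rad.
rewrite ltr_pdivlMr // mulrBl mulrAC [(1 + eps) * _]mulrC -deltaE.
have nE : n%:R = n.-1%:R + 1 :> R by rewrite natr1 prednK.
rewrite {1}nE mulrDl mul1r in ln_pow; move: lt_K; rewrite /ABC_pair_f; lra.
Qed.

End Estimates.

Theorem theorem1 (R : realType) (N : nat) (hN : (0 < N)%N)
  (H : forall eps : R, 0 < eps ->
     exists C : R, forall a b c : int,
       ABC_solution a b c -> (N%:Z %| a * b * c)%Z -> ABC_f a b c eps < C) :
  forall eps : R, 0 < eps ->
    exists C' : R, forall a b c : int,
      ABC_solution a b c -> ABC_f a b c eps < C'.
Proof.
move=> eps eps_gt0; pose n := (N * totient N).*2.
have totN_gt0 : (0 < totient N)%N by rewrite totient_gt0.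
have N_le_n : (N <= n)%N.
  by rewrite /n -addnn -mulnDr leq_pmulr // addn_gt0 totN_gt0.
have totN_dvd : (totient N %| n)%N by rewrite /n -muln2 dvdn_mulr ?dvdn_mull.
have [K bound] := H _ (contracted_eps_gt0 n eps_gt0); eexists => a b c.
case/ABC_solution_exists_pair=> x [y [xy_pair -> -> ->]].
have [u [v [uv_pair N_dvd le_pow le_rad]]] :=
  congruent_ABC_pair hN N_le_n totN_dvd xy_pair.
have n_gt0 := leq_trans hN N_le_n.
rewrite ABC_f_pairE.
apply: (ABC_pair_f_descent n_gt0 eps_gt0 xy_pair uv_pair) => //.
rewrite -ABC_f_pairE; apply: bound; first exact: ABC_solution_pair.
by rewrite dvdzE absz_ABC_product.
Qed.
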